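(* Let $h:\mathbb{N}\to\mathbb{C}$ be an arithmetic function such that $(\mu*h)(n)\ll n^{\beta}$, where $\beta<2$ is a fixed real number. For $a,b\in\mathbb{N}$ put $f(a,b)=\gcd(ab,a+b)/\gcd(a,b)$. Then for real $x>1$, $$\sum_{a,b\le x} h(f(a,b)) = x^2\sum_{n=1}^{\infty}\frac{(\mu*h)(n)}{n^2\psi(n)} + R_{\beta}(x),$$ where $$R_{\beta}(x)\ll\begin{cases} x^{1+\beta/2}\log x, & \text{if } 0<\beta<2,\\ x(\log x)^3, & \text{if } \beta=0 \text{ and } \sum_{n=1}^{\infty}|(\mu*h)(n)|/n=\infty,\\ x(\log x)^2, & \text{if } \beta=0 \text{ and } \sum_{n=1}^{\infty}|(\mu*h)(n)|/n<\infty, \text{ or } \beta<0.\end{cases}$$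
   Context: $\mathbb{N}=\{1,2,\ldots\}$; sums over $a,b\le x$ run over all ordered pairs $(a,b)\in\mathbb{N}^2$ with $a\le x$ and $b\le x$. The function $f$ takes positive integer values. $\mu$ is the Möbius function, $*$ is Dirichlet convolution, so $(\mu*h)(n)=\sum_{d\mid n}\mu(n/d)h(d)$, and $\psi(n)=n\prod_{p\mid n}(1+1/p)$ (product over primes $p$) is the Dedekind function.
   Formalization: The bound on R_β(x) is asserted for x ≥ x0 with an implied constant depending on x0, for every x0 > 1, since one constant for all x > 1 is impossible: log x → 0 as x → 1 while R_β(x) need not tend to 0. *)

(* Defs.v *)
From mathcomp Require Import all_boot all_order all_algebra.
From mathcomp Require Import all_classical all_reals all_analysis.
From mathcomp Require Import complex.

Set Implicit Arguments.
Unset Strict Implicit.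
Unset Printing Implicit Defensive.

Import Order.TTheory GRing.Theory Num.Theory.
Import numFieldNormedType.Exports.

Local Open Scope ring_scope.
Local Open Scope complex_scope.
Local Open Scope classical_set_scope.

(* Arithmetic functions are functions on [nat] of which only the values at
   positive integers are used. *)

Definition moebius (n : nat) : int :=
  if all (fun p => logn p n == 1%N) (primes n) then (-1) ^+ size (primes n)
  else 0.

Definition dirichlet (A : pzRingType) (u v : nat -> A) (n : nat) : A :=
  \sum_(d <- divisors n) u (n %/ d)%N * v d.

Definition moebius_conv (A : pzRingType) (h : nat -> A) : nat -> A :=
  dirichlet (fun n => (moebius n)%:~R) h.

Definition dedekind_psi (F : fieldType) (n : nat) : F :=
  n%:R * \prod_(p <- primes n) (1 + p%:R^-1).

(* The division is exact. *)
Definition gcd_ratio (a b : nat) : nat :=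
  (gcdn (a * b) (a + b) %/ gcdn a b)%N.

Definition modulus (R : rcfType) (z : R[i]) : R := ComplexField.Normc.normc z.

Definition gcd_ratio_sum (R : realType) (h : nat -> R[i]) (x : R) : R[i] :=
  \sum_(1 <= a < (Num.truncn x).+1) \sum_(1 <= b < (Num.truncn x).+1)
    h (gcd_ratio a b).

(* [R[i]^o] carries the usual topology of the complex plane. *)
Definition series_sum (R : realType) (u : nat -> R[i]) (S : R[i]) : Prop :=
  (fun N : nat => \sum_(1 <= n < N) u n : R[i]^o) @ \oo --> (S : R[i]^o).

(* Vinogradov's r(x) << g(x) for x > 1.  The implied constant is uniform on
   every half-line [x0, +oo[ with x0 > 1, but not on the whole of ]1, +oo[:
   the bounds at hand contain powers of log x, which vanish as x -> 1. *)
Definition vinogradov (R : realType) (r : R -> R[i]) (g : R -> R) : Prop :=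
  forall x0 : R, 1 < x0 ->
    exists C : R, forall x : R, x0 <= x -> modulus (r x) <= C * g x.

(* Main.v *)
Require Import Defs.
From mathcomp Require Import all_boot all_order all_algebra.
From mathcomp Require Import all_classical all_reals all_analysis.
From mathcomp Require Import complex.
From mathcomp Require Import ring lra zify.

(* Write g = mu * h.  If a and b have gcd d, then f(a, b) = gcd(d, (a + b)/d),
   so the sum is the sum over n of g(n) N_n(x), where N_n(x) counts the pairs
   with n | d and n | (a + b)/d; after division by n it counts the pairs up to
   x/n with n | (a + b)/gcd(a, b).
   The pairs whose gcd is moreover prime to n are exactly those with
   gcd(a, n) = 1 and n | a + b; periodicity modulo n gives
   phi(n) y^2 / n^2 + O(y) of them up to y.  The primes p of n are readmitted
   in the gcd one at a time: if D(y) and D'(y) are the errors after and before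
   readmitting p, then D(y) = D'(y) + D(y/p), which costs a factor
   1/(1 - p^-2) in the main term and 1/(1 - 1/p) in the error.  Altogether
     |N_n(x) - x^2/(n^2 psi(n))| <= 2 (x/n) prod_(p | n) (1 - 1/p)^-1
                                 <= 2 (x/n) (1 + omega(n)).
   As f(a, b)^2 <= a + b, only n <= sqrt(2x) occur, and the rest of the series
   is bounded by the tail of sum n^(beta - 3). *)

Set Implicit Arguments.
Unset Strict Implicit.
Unset Printing Implicit Defensive.

Import Order.TTheory GRing.Theory Num.Theory.
Import numFieldNormedType.Exports.

Local Open Scope ring_scope.
Local Open Scope complex_scope.

(** * Counting pairs by the gcd *)

Lemma sum_multiples (V : nmodType) (p M : nat) (u : nat -> V) : (0 < p)%N ->
  \sum_(1 <= a < M.+1 | (p %| a)%N) u a =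
  \sum_(1 <= a < (M %/ p).+1) u (p * a)%N.
Proof.
move=> p0; elim: M => [|M IH]; first by rewrite div0n !big_geq.
rewrite (divnS _ p0) big_mkcond big_nat_recr //= -big_mkcond /= {}IH.
case: ifP => [pM|_]; last by rewrite add0n addr0.
rewrite add1n [RHS]big_nat_recr //=; congr (_ + u _).
by rewrite -[LHS](divnK pM) mulnC (divnS _ p0) pM add1n.
Qed.

Lemma sum_divisors (V : nmodType) (n K : nat) (u : nat -> V) :
  (0 < n <= K)%N ->
  \sum_(d <- divisors n) u d = \sum_(1 <= d < K.+1 | (d %| n)%N) u d.
Proof.
move=> /andP[n0 nK]; rewrite -[RHS]big_filter; apply: perm_big.
apply: uniq_perm; rewrite ?divisors_uniq ?filter_uniq ?iota_uniq // => d.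
rewrite mem_filter mem_index_iota -dvdn_divisors // andbC ltnS.
case: (boolP (d %| n)%N) => //= dn; last by rewrite andbF.
by rewrite (dvdn_gt0 n0 dn) (leq_trans (dvdn_leq n0 dn) nK).
Qed.

Definition gcd_quot (a b : nat) : nat := ((a + b) %/ gcdn a b)%N.

Lemma gcd_quot_scale p a b : (0 < p)%N ->
  gcd_quot (p * a) (p * b) = gcd_quot a b.
Proof. by move=> p0; rewrite /gcd_quot -muln_gcdr -mulnDr divnMl. Qed.

(** Write a = g a', b = g b' with g the gcd. Then a' b' is coprime to a' + b', so it drops out of
    gcd(g a' b', a' + b'). *)
Lemma gcd_ratioE a b : (0 < a)%N -> (0 < b)%N ->
  gcd_ratio a b = gcdn (gcdn a b) (gcd_quot a b).
Proof.
move=> a0 b0; rewrite /gcd_ratio /gcd_quot.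
set g := gcdn a b; have g0 : (0 < g)%N by rewrite gcdn_gt0 a0.
have [a' Ea] := dvdnP (dvdn_gcdl a b).
have [b' Eb] := dvdnP (dvdn_gcdr a b).
rewrite -/g in Ea Eb.
have cop : coprime a' b'.
  rewrite /coprime -(eqn_pmul2r g0) mul1n; apply/eqP.
  by rewrite muln_gcdl -Ea -Eb.
have -> : (a + b = (a' + b') * g)%N by rewrite mulnDl -Ea -Eb.
rewrite mulnK // {1}Ea {1}Eb.
have -> : (a' * g * (b' * g) = (g * (a' * b')) * g)%N by ring.
rewrite -muln_gcdl mulnK // gcdnC [RHS]gcdnC Gauss_gcdl //.
rewrite coprime_sym coprimeMl.
by rewrite /coprime gcdnDl gcdnDr [gcdn b' a']gcdnC andbb.
Qed.

Definition paircount (P : nat -> nat -> bool) (M : nat) : nat :=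
  \sum_(1 <= a < M.+1) \sum_(1 <= b < M.+1) P a b.

Lemma eq_paircount (P Q : nat -> nat -> bool) M :
  (forall a b, (0 < a <= M)%N -> (0 < b <= M)%N -> P a b = Q a b) ->
  paircount P M = paircount Q M.
Proof.
move=> PQ; apply: eq_big_nat => a Ha; apply: eq_big_nat => b Hb.
by rewrite PQ.
Qed.

Lemma paircount_split (Q P : nat -> nat -> bool) M :
  paircount P M = (paircount (fun a b => P a b && ~~ Q a b) M +
                  paircount (fun a b => P a b && Q a b) M)%N.
Proof.
rewrite /paircount -big_split; apply: eq_bigr => a _.
rewrite -big_split; apply: eq_bigr => b _ /=.
by case: (P a b); case: (Q a b).
Qed.

Lemma paircount_scale (P : nat -> nat -> bool) p M : (0 < p)%N ->
  paircount (fun a b => [&& p %| a, p %| b & P a b]%N) M =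
  paircount (fun a b => P (p * a) (p * b))%N (M %/ p).
Proof.
move=> p0; rewrite /paircount -(@sum_multiples _ p M
  (fun a => \sum_(1 <= b < (M %/ p).+1) P a (p * b)%N)%N) //.
rewrite [RHS]big_mkcond; apply: eq_bigr => a _.
case: (p %| a)%N => /=; last by rewrite big1.
rewrite -(@sum_multiples _ p M (fun b => nat_of_bool (P a b))) //.
by rewrite [RHS]big_mkcond; apply: eq_bigr => b _; case: (p %| b)%N.
Qed.

(* [s] lists the primes not yet readmitted in the gcd. *)
Definition ratio_count (n : nat) (s : seq nat) (M : nat) : nat :=
  paircount (fun a b => (n %| gcd_quot a b)%N &&
    all (fun p => ~~ (p %| gcdn a b)%N) s) M.

(** Split according to whether p divides gcd(a, b). If it does, dividing a and b by p changes
    neither [gcd_quot] nor the divisibility of the gcd by the primes of s, all different from p. *)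
Lemma ratio_count_cons n p s M : prime p -> all prime s -> p \notin s ->
  ratio_count n s M = (ratio_count n (p :: s) M + ratio_count n s (M %/ p))%N.
Proof.
move=> pp ps pNs; have p0 := prime_gt0 pp.
rewrite /ratio_count (paircount_split (fun a b => p %| gcdn a b)%N); congr addn.
  by apply: eq_paircount => a b _ _ /=; rewrite -andbA [_ && ~~ _]andbC.
transitivity (paircount (fun a b => [&& p %| a, p %| b &
    (n %| gcd_quot a b) && all (fun q => ~~ (q %| gcdn a b)) s]%N) M).
  by apply: eq_paircount => a b _ _; rewrite dvdn_gcd andbC -andbA.
rewrite paircount_scale //; apply: eq_paircount => a b _ _.
rewrite gcd_quot_scale //; congr andb; apply: eq_in_all => q qs.
rewrite -muln_gcdr Euclid_dvdM ?(allP ps q qs) //.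
rewrite dvdn_prime2 ?(allP ps q qs) //.
by case: eqP qs => // ->; rewrite (negbTE pNs).
Qed.

(** Once the gcd is prime to n, it can be cancelled in the condition n | (a + b)/gcd(a, b). Given n
    | a + b, a common divisor of n and a also divides b, so gcd(a, b) is prime to n exactly when a
    is. *)
Lemma ratio_count_primes n M : (0 < n)%N ->
  ratio_count n (primes n) M =
  (\sum_(1 <= a < M.+1 | coprime n a) \sum_(1 <= b < M.+1) (n %| a + b)%N)%N.
Proof.
move=> n0; rewrite [RHS]big_mkcond /=; apply: eq_big_nat => a /andP[a0 _].
transitivity (\sum_(1 <= b < M.+1) (coprime n a && (n %| a + b)%N)%N)%N;
    last first.
  by case: (coprime n a) => //=; rewrite big1.
apply: eq_big_nat => b /andP[b0 _]; congr nat_of_bool.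
have g0 : (0 < gcdn a b)%N by rewrite gcdn_gt0 a0.
have -> : all (fun p => ~~ (p %| gcdn a b)%N) (primes n) = coprime n (gcdn a b).
  rewrite coprime_sym coprime_has_primes // -all_predC; apply: eq_in_all => p.
  by rewrite mem_primes => /and3P[pp _ _] /=; rewrite mem_primes pp g0.
have dab : (gcdn a b %| a + b)%N by rewrite dvdn_add ?dvdn_gcdl ?dvdn_gcdr.
apply/andP/andP => -[H1 H2].
  have nab : (n %| a + b)%N by rewrite -(divnK dab) dvdn_mulr.
  split=> //; move: H2; rewrite /coprime => /eqP E; apply/eqP.
  apply/eqP; rewrite -dvdn1 -E !dvdn_gcd dvdn_gcdl dvdn_gcdr /=.
  by rewrite -(dvdn_addr _ (dvdn_gcdr n a)) (dvdn_trans (dvdn_gcdl n a)).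
have cg := coprime_dvdr (dvdn_gcdl a b) H1.
by split=> //; rewrite -(Gauss_dvdl _ cg) divnK.
Qed.

Lemma ratio_count_gcd_ratio n M : (0 < n)%N ->
  paircount (fun a b => n %| gcd_ratio a b)%N M = ratio_count n [::] (M %/ n).
Proof.
move=> n0; rewrite /ratio_count.
transitivity (paircount (fun a b => [&& n %| a, n %| b &
    (n %| gcd_quot a b)]%N) M).
  apply: eq_paircount => a b /andP[a0 _] /andP[b0 _].
  by rewrite gcd_ratioE // !dvdn_gcd andbA.
rewrite paircount_scale //; apply: eq_paircount => a b _ _.
by rewrite gcd_quot_scale // andbT.
Qed.

(** The ratio divides both factors of a + b = gcd(a, b) * [gcd_quot a b]. This yields the cutoff n
    <= sqrt(2x). *)
Lemma gcd_ratio_sqr_le a b : (0 < a)%N -> (0 < b)%N ->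
  (gcd_ratio a b ^ 2 <= a + b)%N.
Proof.
move=> a0 b0; rewrite gcd_ratioE //.
have g0 : (0 < gcdn a b)%N by rewrite gcdn_gt0 a0.
have dab : (gcdn a b %| a + b)%N by rewrite dvdn_add ?dvdn_gcdl ?dvdn_gcdr.
have q0 : (0 < gcd_quot a b)%N by rewrite divn_gt0 // dvdn_leq // addn_gt0 a0.
rewrite -(divnK dab) mulnC leq_mul //.
  by rewrite dvdn_leq // dvdn_gcdl.
by rewrite dvdn_leq // dvdn_gcdr.
Qed.

Lemma gcd_ratio_gt0 a b : (0 < a)%N -> (0 < b)%N -> (0 < gcd_ratio a b)%N.
Proof. by move=> a0 b0; rewrite gcd_ratioE // !gcdn_gt0 a0. Qed.

(** * Periodic counting and coprime pairs *)

Lemma periodic_window n (P : nat -> bool) m : (forall k, P (k + n)%N = P k) ->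
  (\sum_(m <= k < m + n) P k = \sum_(0 <= k < n) P k)%N.
Proof.
move=> Pn; elim: m => [|m <-] //.
apply: (@addnI (P m)); rewrite addSn -big_ltn; last by lia.
by rewrite big_nat_recr ?leq_addr //= Pn addnC.
Qed.

Lemma periodic_count n (P : nat -> bool) M :
  (0 < n)%N -> (forall k, P (k + n)%N = P k) ->
  ((M %/ n) * (\sum_(0 <= k < n) P k) <= \sum_(1 <= k < M.+1) P k <=
    (M %/ n).+1 * (\sum_(0 <= k < n) P k))%N.
Proof.
move=> n0 Pn.
have E q : (\sum_(1 <= k < (q * n).+1) P k = q * \sum_(0 <= k < n) P k)%N.
  elim: q => [|q IH]; first by rewrite big_geq.
  rewrite (big_cat_nat (n := (q * n).+1)) //=; last by lia.
  by rewrite IH mulSn [(n + _)%N]addnC -addSn periodic_window // mulSn addnC.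
have mono a b : (a <= b)%N ->
    (\sum_(1 <= k < a.+1) P k <= \sum_(1 <= k < b.+1) P k)%N.
  by move=> ab; rewrite [leqRHS](big_cat_nat (n := a.+1)) //= leq_addr.
by rewrite -!E !mono // ?leq_trunc_div // ltnW // ltn_ceil.
Qed.

(** Dividing the real bound y by p matches integer division of its truncation, so the recursion on
    counts can be run in y. *)
Lemma truncn_divn (R : archiRealFieldType) (y : R) (p : nat) :
  0 <= y -> (0 < p)%N -> Num.truncn (y / p%:R) = (Num.truncn y %/ p)%N.
Proof.
move=> y0 p0; have p0R : 0 < p%:R :> R by rewrite ltr0n.
have /andP[ty yt] := truncn_itv y0.
apply: truncn_def; rewrite ler_pdivlMr // ltr_pdivrMr // -!natrM.
rewrite (le_trans _ ty) ?ler_nat ?leq_trunc_div //.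
by rewrite (lt_le_trans yt) // ler_nat ltn_ceil.
Qed.

Lemma periodic_count_approx (R : archiRealFieldType) n (P : nat -> bool) c
    (y : R) : (0 < n)%N -> 0 <= y -> (forall k, P (k + n)%N = P k) ->
  (\sum_(0 <= k < n) P k)%N = c ->
  `|(\sum_(1 <= k < (Num.truncn y).+1) P k)%N%:R - c%:R * (y / n%:R)| <= c%:R.
Proof.
move=> n0 y0 Pn <-; set c' := (\sum_(0 <= k < n) P k)%N.
have /andP[lo up] := periodic_count (Num.truncn y) n0 Pn.
have := truncn_itv (divr_ge0 y0 (ler0n R n)).
rewrite truncn_divn // => /andP[ly yl].
have c0 : 0 <= c'%:R :> R by rewrite ler0n.
have {lo} := lo; have {up} := up; rewrite -!(ler_nat R) !natrM -/c'.
rewrite -natr1 in yl * => up lo.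
have := ler_wpM2l c0 ly; have := ler_wpM2l c0 (ltW yl).
by rewrite ler_norml; move: up lo; rewrite -!/c'; lra.
Qed.

Lemma totient_le n : (totient n <= n)%N.
Proof.
rewrite totient_count_coprime -[leqRHS]subn0 -[leqRHS]muln1 -sum_nat_const_nat.
by apply: leq_sum => i _; case: (coprime n i).
Qed.

Lemma dvdn_period n a : (0 < n)%N -> (\sum_(0 <= b < n) (n %| a + b) = 1)%N.
Proof.
move=> n0; have E : (\sum_(0 <= b < n) (n %| b) = 1)%N.
  rewrite big_ltn // dvdn0 big1_seq // => b.
  rewrite mem_index_iota => /= /andP[b0 bn].
  by rewrite gtnNdvd.
(* As b runs over 0, ..., n - 1, the sum a + b runs over the window of length n starting at a. *)
rewrite -[RHS]E -[RHS](periodic_window (P := fun b => n %| b)%N a); last first.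
  by move=> k; rewrite dvdn_addl.
rewrite -[in RHS](add0n a) big_addn add0n addKn.
by apply: eq_bigr => b _; rewrite addnC.
Qed.

(** Each a prime to n leaves one class of b modulo n, hence y/n + O(1) values, with total error at
    most y. The number of such a is phi(n) y/n + O(phi(n)), and multiplying by y/n costs at most
    phi(n) y/n <= y more. *)
Lemma coprime_pairs_approx (R : archiRealFieldType) n (y : R) :
  (0 < n)%N -> 0 <= y ->
  `|(ratio_count n (primes n) (Num.truncn y))%:R -
    (totient n)%:R / n%:R ^+ 2 * y ^+ 2| <= 2 * y.
Proof.
move=> n0 y0; rewrite ratio_count_primes //; set M := Num.truncn y.
have n0R : 0 < n%:R :> R by rewrite ltr0n.
have My : M%:R <= y by rewrite truncn_le.
pose A := (\sum_(1 <= a < M.+1) coprime n a)%N.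
have Aest : `|A%:R - (totient n)%:R * (y / n%:R)| <= (totient n)%:R.
  apply: periodic_count_approx => //.
    by move=> k; rewrite /coprime gcdnDr.
  by rewrite totient_count_coprime.
have Best : `|(\sum_(1 <= a < M.+1 | coprime n a)
    \sum_(1 <= b < M.+1) (n %| a + b))%N%:R - A%:R * (y / n%:R)| <= y.
  apply: le_trans My; rewrite natr_sum /A natr_sum mulr_suml big_mkcond /=.
  rewrite -sumrB (le_trans (ler_norm_sum _ _ _)) //.
  have -> : M%:R = \sum_(1 <= a < M.+1) 1 :> R.
    by rewrite big_const_nat subSS subn0 iter_addr addr0.
  apply: ler_sum => a _; case: (coprime n a); last first.
    by rewrite mul0r subr0 normr0.
  apply: periodic_count_approx => //; last exact: dvdn_period.
  by move=> k; rewrite addnA dvdn_addl.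
have phi_le : (totient n)%:R * (y / n%:R) <= y.
  by rewrite mulrCA ler_piMr // ler_pdivrMr // mul1r ler_nat totient_le.
have yn0 : 0 <= y / n%:R by rewrite divr_ge0 // ltW.
have -> : (totient n)%:R / n%:R ^+ 2 * y ^+ 2 =
    (totient n)%:R * (y / n%:R) * (y / n%:R).
  by field; rewrite lt0r_neq0.
have H : `|A%:R * (y / n%:R) - (totient n)%:R * (y / n%:R) * (y / n%:R)| <= y.
  rewrite -mulrBl normrM (ger0_norm yn0) (le_trans _ phi_le) //.
  by rewrite ler_wpM2r.
by move: Best H; rewrite !ler_norml; lra.
Qed.

(** * Readmitting the primes of n in the gcd *)

(** The new constants solve c' = c + c'/p^2 and C' = C + C'/p, so main term and error bound obey the
    same recursion from y to y/p as the counts. *)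
Lemma ratio_count_step (R : archiRealFieldType) n p s (c C : R) :
  prime p -> all prime s -> p \notin s -> 0 <= c <= C ->
  (forall y : R, 0 <= y ->
    `|(ratio_count n (p :: s) (Num.truncn y))%:R - c * y ^+ 2| <= C * y) ->
  forall y : R, 0 <= y ->
    `|(ratio_count n s (Num.truncn y))%:R - c / (1 - p%:R ^- 2) * y ^+ 2| <=
      C / (1 - p%:R^-1) * y.
Proof.
move=> pp ps pNs /andP[c0 cC] est.
have p1 : 2 <= p%:R :> R by rewrite (ler_nat _ 2) prime_gt1.
set q := p%:R^-1 : R.
have q0 : 0 < q by rewrite invr_gt0; lra.
have q1 : q <= 2^-1 by rewrite lef_pV2 // posrE; lra.
rewrite -exprVn -/q.
have qq : q ^+ 2 <= q by rewrite expr2 ger_pMl //; lra.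
have cq : c / (1 - q ^+ 2) <= C / (1 - q).
  apply: ler_pM => //; first by rewrite invr_ge0; lra.
  by rewrite lef_pV2 ?posrE; lra.
have cq0 : 0 <= c / (1 - q ^+ 2) by rewrite divr_ge0 //; lra.
suff H M : forall y : R, 0 <= y -> Num.truncn y = M ->
    `|(ratio_count n s M)%:R - c / (1 - q ^+ 2) * y ^+ 2| <= C / (1 - q) * y.
  by move=> y y0; exact: H.
(* Strong induction on the truncation of y, which drops strictly from y to y/p unless it is 0. *)
have [N] := ubnP M; elim: N M => // N IH M MN y y0 yM.
have [M0|M0] := posnP M.
  have y1 : y < 1 by have := truncn_itv y0; rewrite yM M0 => /andP[].
  (* For y < 1 no pair is counted and the error is the main term itself; it is small enough because
     c <= C and y^2 <= y. *)
  rewrite M0 /ratio_count /paircount big_geq // sub0r normrN.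
  rewrite ger0_norm; last exact: mulr_ge0 cq0 (sqr_ge0 y).
  by apply: ler_pM; rewrite ?sqr_ge0 // expr2 ler_piMr // ltW.
rewrite (@ratio_count_cons n p) // -yM -truncn_divn ?prime_gt0 // natrD.
have y'0 : 0 <= y / p%:R by rewrite divr_ge0 ?ler0n.
have := IH _ _ _ y'0 erefl; rewrite {1}truncn_divn ?prime_gt0 //.
have Mp : (Num.truncn y %/ p < N)%N.
  by rewrite yM -ltnS (leq_trans _ MN) // ltnS ltn_Pdiv ?prime_gt1.
move=> /(_ Mp); have := est y y0; rewrite -/q.
set u := _%:R; set v := _%:R => H1 H2.
have -> : u + v - c / (1 - q ^+ 2) * y ^+ 2 =
    (u - c * y ^+ 2) + (v - c / (1 - q ^+ 2) * (y * q) ^+ 2).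
  by field; lra.
have -> : C / (1 - q) * y = C * y + C / (1 - q) * (y * q) by field; lra.
by rewrite (le_trans (ler_normD _ _)) // lerD.
Qed.

Lemma ratio_count_iter (R : archiRealFieldType) n t s (c C : R) :
  all prime (t ++ s) -> uniq (t ++ s) -> 0 <= c <= C ->
  (forall y : R, 0 <= y ->
    `|(ratio_count n (t ++ s) (Num.truncn y))%:R - c * y ^+ 2| <= C * y) ->
  forall y : R, 0 <= y ->
    `|(ratio_count n s (Num.truncn y))%:R -
        c * (\prod_(p <- t) (1 - p%:R ^- 2)^-1) * y ^+ 2| <=
      C * (\prod_(p <- t) (1 - p%:R^-1)^-1) * y.
Proof.
elim: t c C => [|p t IH] c C; first by rewrite !big_nil !mulr1.
rewrite /= => /andP[pp pts] /andP[pN uts] /andP[c0 cC] est y y0.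
rewrite !big_cons [c * (_ * _)]mulrA [C * (_ * _)]mulrA.
have S := ratio_count_step pp pts pN (introT andP (conj c0 cC)) est.
apply: (IH _ _ pts uts _ S) => //.
(* It remains to see that the condition 0 <= c <= C survives the step, which holds since 1 - q^2 >=
   1 - q > 0 for q = 1/p. *)
have p1 : 2 <= p%:R :> R by rewrite (ler_nat _ 2) prime_gt1.
rewrite -exprVn; set q := p%:R^-1.
have q0 : 0 < q by rewrite invr_gt0; lra.
have q1 : q <= 2^-1 by rewrite lef_pV2 // posrE; lra.
have qq : q ^+ 2 <= q by rewrite expr2 ger_pMl //; lra.
rewrite divr_ge0 //=; last lra.
apply: ler_pM => //; first by rewrite invr_ge0; lra.
by rewrite lef_pV2 ?posrE; lra.
Qed.

(** * Euler products over the primes of n *)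

Lemma totient_prod (F : numFieldType) n : (0 < n)%N ->
  (totient n)%:R = n%:R * \prod_(p <- primes n) (1 - p%:R^-1) :> F.
Proof.
move=> n0; rewrite totientE // [n in n%:R * _](prod_prime_decomp n0).
rewrite prime_decompE big_map.
rewrite !natr_prod -big_split; apply: eq_big_seq => p pn /=.
have pp : prime p by move: pn; rewrite mem_primes => /and3P[].
have p0 : p%:R != 0 :> F by rewrite pnatr_eq0 -lt0n prime_gt0.
move: pn; rewrite -logn_gt0; case: (logn p n) => // k _.
rewrite -pred_Sn expnS !natrM -subn1 natrB ?prime_gt0 //.
by field.
Qed.

(** Prime by prime, (1 - q)/(1 - q^2) = 1/(1 + q) with q = 1/p. *)
Lemma totient_psi (F : numFieldType) n : (0 < n)%N ->
  (totient n)%:R / n%:R ^+ 2 * (\prod_(p <- primes n) (1 - p%:R ^- 2)^-1) =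
    (dedekind_psi F n)^-1.
Proof.
move=> n0; rewrite /dedekind_psi totient_prod // invfM.
have n0F : n%:R != 0 :> F by rewrite pnatr_eq0 -lt0n.
rewrite -[in RHS]prodfV.
transitivity (n%:R^-1 * ((\prod_(p <- primes n) (1 - p%:R^-1)) *
  (\prod_(p <- primes n) (1 - p%:R ^- 2)^-1)) : F).
  by field.
rewrite -big_split; congr (_ * _); apply: eq_big_seq => p.
rewrite mem_primes => /and3P[pp _ _] /=.
rewrite -exprVn; set q := p%:R^-1.
have q1 : q < 1.
  by rewrite invf_lt1 ?ltr1n ?ltr0n ?prime_gt1 ?prime_gt0.
have -> : 1 - q ^+ 2 = (1 - q) * (1 + q) by ring.
by rewrite invfM mulrA divff ?mul1r // subr_eq0 gt_eqF.
Qed.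

(** The i-th entry of s is at least k + i, so its factor is at most (k + i)/(k + i - 1), and these
    bounds telescope. A general k is needed for the induction; k = 1 gives 1 + omega(n). *)
Lemma prod_primes_bound (F : numFieldType) k (s : seq nat) : (0 < k)%N ->
  path ltn k s ->
  \prod_(p <- s) (1 - p%:R^-1)^-1 <= (k + size s)%:R / k%:R :> F.
Proof.
elim: s k => [|p s IH] k k0 /=.
  by rewrite big_nil addn0 divff // pnatr_eq0 -lt0n.
move=> /andP[kp ps]; rewrite big_cons addnS -addSn.
have p0 : (0 < p)%N by exact: leq_ltn_trans kp.
have k0F : 0 < k%:R :> F by rewrite ltr0n.
have pkF : k%:R <= p%:R - 1 :> F by rewrite lerBrDr natr1 ler_nat.
have p1F : 0 < p%:R - 1 :> F by exact: lt_le_trans pkF.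
have p0F : 0 < p%:R :> F by rewrite ltr0n.
have q0 : 0 < 1 - p%:R^-1 :> F.
  by rewrite subr_gt0 invf_lt1 // -subr_gt0.
apply: (@le_trans _ _ ((1 - p%:R^-1)^-1 * ((p + size s)%:R / p%:R))).
  by rewrite ler_wpM2l ?IH // invr_ge0 ltW.
have -> : (1 - p%:R^-1)^-1 * ((p + size s)%:R / p%:R) =
    1 + (size s).+1%:R / (p%:R - 1) :> F.
  by rewrite natrD -natr1; field; rewrite !gt_eqF.
have -> : (k.+1 + size s)%:R / k%:R = 1 + (size s).+1%:R / k%:R :> F.
  by rewrite addSnnS natrD mulrDl divff // gt_eqF.
by rewrite lerD2l ler_wpM2l // lef_pV2.
Qed.

Lemma exp2_primes n : (0 < n)%N -> (2 ^ size (primes n) <= n)%N.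
Proof.
move=> n0; rewrite {2}(prod_prime_decomp n0) prime_decompE big_map /=.
have H : all (fun p => 2 <= p ^ logn p n)%N (primes n).
  apply/allP => p pn; have := pn; rewrite -logn_gt0 => lp.
  move: pn; rewrite mem_primes => /and3P[pp _ _].
  by rewrite (leq_trans (prime_gt1 pp)) // -{1}[p]expn1 leq_exp2l ?prime_gt1.
elim: (primes n) H => [|p s IH] /=; first by rewrite big_nil.
by move=> /andP[H1 H2]; rewrite big_cons expnS leq_mul ?IH.
Qed.

Lemma ratio_count_approx (R : archiRealFieldType) n (y : R) : (0 < n)%N ->
  0 <= y ->
  `|(ratio_count n [::] (Num.truncn y))%:R - y ^+ 2 / dedekind_psi R n| <=
    2 * (1 + (size (primes n))%:R) * y.
Proof.
move=> n0 y0.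
have n0R : 0 < n%:R :> R by rewrite ltr0n.
have pp : all prime (primes n).
  by apply/allP => p; rewrite mem_primes => /and3P[].
(* The iteration starts from the coprime count, with c = phi(n)/n^2 and C = 2, and readmits every
   prime of n. *)
have := @ratio_count_iter R n (primes n) [::] ((totient n)%:R / n%:R ^+ 2) 2.
rewrite cats0 totient_psi // => /(_ pp (primes_uniq n)) H.
have {}H : `|(ratio_count n [::] (Num.truncn y))%:R -
    (dedekind_psi R n)^-1 * y ^+ 2| <=
    2 * (\prod_(p <- primes n) (1 - p%:R^-1)^-1) * y.
  apply: H => // [|z z0]; last exact: coprime_pairs_approx.
  rewrite divr_ge0 ?sqr_ge0 //= ler_pdivrMr ?exprn_gt0 //.
  rewrite -natrX -natrM ler_nat (leq_trans (totient_le n)) //.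
  by rewrite -mulnn mulnCA leq_pmulr // muln_gt0.
rewrite mulrC (le_trans H) // ler_wpM2r // ler_wpM2l //.
have pn : path ltn 1%N (primes n).
  rewrite path_min_sorted ?sorted_primes //.
  by apply/allP => p; rewrite mem_primes => /and3P[/prime_gt1].
by have := prod_primes_bound R (isT : (0 < 1)%N) pn; rewrite divr1 natrD.
Qed.

Lemma gcd_ratio_count_approx (R : archiRealFieldType) n (x : R) : (0 < n)%N ->
  0 <= x ->
  `|(paircount (fun a b => n %| gcd_ratio a b)%N (Num.truncn x))%:R -
      x ^+ 2 / (n%:R ^+ 2 * dedekind_psi R n)| <=
    2 * (1 + (size (primes n))%:R) * (x / n%:R).
Proof.
move=> n0 x0; rewrite ratio_count_gcd_ratio // -truncn_divn //.
rewrite invfM [x ^+ 2 * _]mulrA -expr_div_n.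
by apply: ratio_count_approx => //; rewrite divr_ge0.
Qed.

(** * Moebius inversion *)

Lemma moebius_mul_prime p d : prime p -> (0 < d)%N -> ~~ (p %| d)%N ->
  moebius (p * d) = - moebius d.
Proof.
move=> pp d0 pd; have p0 := prime_gt0 pp.
have perm : perm_eq (primes (p * d)) (p :: primes d).
  apply: uniq_perm; rewrite /= ?primes_uniq ?mem_primes ?(negbTE pd) ?andbF //.
  by move=> q; rewrite primesM // primes_prime // mem_seq1 in_cons.
rewrite /moebius (perm_all _ perm) (perm_size perm) /=.
rewrite lognM // (lognE p p) pp p0 dvdnn divnn p0 logn1 /=.
rewrite (lognE p d) (negbTE pd) !andbF /=.
have -> : all (fun q => logn q (p * d) == 1%N) (primes d) =
    all (fun q => logn q d == 1%N) (primes d).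
  apply: eq_in_all => q; rewrite mem_primes => /and3P[pq _ qd].
  rewrite lognM // logn_prime //.
  by case: (q =P p) qd => // ->; rewrite (negbTE pd).
by case: ifP; rewrite ?oppr0 // exprS mulN1r.
Qed.

Lemma moebius_sqr_dvd p d : prime p -> (0 < d)%N -> (p %| d)%N ->
  moebius (p * d) = 0.
Proof.
move=> pp d0 pd; rewrite /moebius ifF //; apply/negbTE/allPn; exists p.
  by rewrite mem_primes pp muln_gt0 prime_gt0 // d0 dvdn_mulr.
rewrite lognM //; last exact: prime_gt0.
rewrite logn_prime // eqxx add1n eqSS -lt0n logn_gt0.
by rewrite mem_primes pp d0.
Qed.

(* Pairing each divisor d prime to p = pdiv n with p * d cancels the sum. *)
Lemma sum_moebius n : (0 < n)%N ->
  \sum_(d <- divisors n) moebius d = (n == 1%N)%:R.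
Proof.
move=> n0; case: eqP => [->|n1]; first by rewrite big_seq1.
have pp : prime (pdiv n).
  by rewrite pdiv_prime // ltn_neqAle eq_sym n0 andbT; apply/eqP.
set p := pdiv n in pp; have p0 := prime_gt0 pp.
rewrite (@sum_divisors _ n n) ?n0 ?leqnn // (bigID (fun d => p %| d)%N) /=.
rewrite (eq_bigl (fun d => (p %| d) && (d %| n))%N);
  last by move=> d; rewrite andbC.
rewrite big_mkcondr sum_multiples //.
(* A divisor d of n prime to p satisfies p d | n, hence d <= n/p; both sums then have the same range
   and cancel termwise. *)
rewrite (_ : \sum_(1 <= d < n.+1 | (d %| n)%N && ~~ (p %| d)%N) moebius d =
    \sum_(1 <= d < (n %/ p).+1 | (d %| n)%N && ~~ (p %| d)%N) moebius d).
  rewrite [X in _ + X]big_mkcond -big_split big1_seq //= => d.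
  rewrite mem_index_iota => /andP[d0 _].
  case: (boolP (p %| d)%N) => pd; rewrite ?andbF ?andbT.
    by rewrite moebius_sqr_dvd // addr0; case: ifP.
  have -> : (p * d %| n)%N = (d %| n)%N.
    by rewrite Gauss_dvd ?prime_coprime // pdiv_dvd.
  by case: ifP; rewrite ?addr0 // moebius_mul_prime // addNr.
have np : ((n %/ p).+1 <= n.+1)%N by rewrite ltnS leq_div.
rewrite (big_cat_nat (n := (n %/ p).+1)) //= [X in _ + X]big1_seq ?addr0 //.
move=> d; rewrite mem_index_iota => /andP[/andP[dn pd] /andP[npd _]].
move: npd; rewrite ltnNge leq_divRL // => /negP[]; apply: dvdn_leq => //.
by rewrite Gauss_dvd ?dn ?pdiv_dvd // coprime_sym prime_coprime.
Qed.

(** The coefficient of h(e) is the sum of mu over the divisors of n/e. The free bound K gives all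
    divisor sums a common range, so that sums can be exchanged here and when summing over pairs. *)
Lemma moebius_inversion (A : pzRingType) (h : nat -> A) n K : (0 < n <= K)%N ->
  h n = \sum_(1 <= d < K.+1 | (d %| n)%N) moebius_conv h d.
Proof.
move=> /andP[n0 nK].
have inner d : (d %| n)%N -> (0 < d)%N -> moebius_conv h d =
    \sum_(1 <= e < K.+1 | (e %| d)%N) (moebius (d %/ e))%:~R * h e.
  move=> dn d0; rewrite /moebius_conv /dirichlet (@sum_divisors _ d K) //.
  by rewrite d0 (leq_trans (dvdn_leq n0 dn)).
transitivity (\sum_(1 <= d < K.+1 | (d %| n)%N)
    \sum_(1 <= e < K.+1 | (e %| d)%N) (moebius (d %/ e))%:~R * h e); last first.
  by apply: congr_big_nat => // d /and3P[dn d0 _]; rewrite inner.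
rewrite (exchange_big_dep_nat (fun e => e %| n)%N) /=; last first.
  by move=> d e _ _ dn ed; exact: dvdn_trans ed dn.
transitivity (\sum_(1 <= e < K.+1 | (e %| n)%N) (n == e)%:R * h e).
  rewrite big_mkcond (bigD1_seq n) /= ?iota_uniq ?mem_index_iota ?n0 //.
  rewrite dvdnn eqxx mul1r big1 ?addr0 // => e /negbTE en.
  by rewrite eq_sym en mul0r if_same.
rewrite [LHS]big_mkcond [RHS]big_mkcond; apply: eq_big_nat => e /andP[e0 eK].
case: ifP => // en; have [m nE] := dvdnP en.
have m0 : (0 < m)%N by move: n0; rewrite nE muln_gt0 => /andP[].
rewrite -mulr_suml; congr (_ * _).
transitivity ((\sum_(k <- divisors m) moebius k)%:~R : A).
  by rewrite sum_moebius // nE -{2}[e]mul1n eqn_pmul2r //; case: eqP.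
rewrite (@sum_divisors _ m (K %/ e)); last first.
  by rewrite m0 leq_divRL // -nE.
(* Substitute d = e k, where k runs over the divisors of m = n/e. *)
rewrite [RHS](eq_bigl (fun d => (e %| d) && (d %| n))%N);
  last by move=> d; rewrite andbC.
rewrite [RHS]big_mkcondr sum_multiples // raddf_sum /= big_mkcond.
by apply: eq_bigr => k _; rewrite mulKn // nE [(m * e)%N]mulnC dvdn_pmul2l.
Qed.

(** * Power sums *)

(** This is 1 + t <= exp t at t = -1/(n + 1). It replaces comparison with an integral, for powers
    and for the logarithm alike. *)
Lemma nat_mul_expR_le (R : realType) n : n%:R * expR n.+1%:R^-1 <= n.+1%:R :> R.
Proof.
have n1 : 0 < n.+1%:R :> R by rewrite ltr0n.
have := expR_ge1Dx (- n.+1%:R^-1 : R); rewrite expRN => H.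
rewrite -ler_pdivlMr ?expR_gt0 //.
apply: le_trans (ler_wpM2l (ltW n1) H).
by rewrite mulrDr mulr1 mulrN divff ?gt_eqF // -natr1 addrK.
Qed.

Lemma powR_succ_ge (R : realType) (b : R) n : 0 <= b ->
  n%:R `^ b * (1 + b / n.+1%:R) <= n.+1%:R `^ b.
Proof.
move=> b0; have e0 : 0 <= expR n.+1%:R^-1 :> R by exact: expR_ge0.
apply: (@le_trans _ _ ((n%:R * expR n.+1%:R^-1) `^ b)); last first.
  by apply: ge0_ler_powR; rewrite ?nnegrE ?mulr_ge0 ?ler0n ?nat_mul_expR_le.
rewrite powRM ?ler0n // -expRM ler_wpM2l ?powR_ge0 //.
by rewrite [b / _]mulrC expR_ge1Dx.
Qed.

(** By [powR_succ_ge], m^b - (m - 1)^b >= m^b b/(m + b). The factor (1 + b)/b makes this at least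
    m^(b - 1), because m + b <= m (1 + b) for m >= 1. *)
Lemma sum_powR_le (R : realType) (b : R) N : 0 < b ->
  \sum_(1 <= n < N.+1) n%:R `^ (b - 1) <= (1 + b) / b * N%:R `^ b.
Proof.
move=> b0; elim: N => [|N IH].
  by rewrite big_geq // mulr_ge0 ?powR_ge0 // divr_ge0; lra.
rewrite big_nat_recr //= (le_trans (lerD IH (lexx _))) //.
have N1 : 0 < N.+1%:R :> R by rewrite ltr0n.
rewrite powRB ?(gt_eqF N1) ?implybT // (powRr1 (ltW N1)).
have := powR_succ_ge N (ltW b0); set u := _ `^ b; set v := _ `^ b => uv.
have v0 : 0 <= v by exact: powR_ge0.
have m1 : 1 <= N.+1%:R :> R by rewrite ler1n.
move: uv m1; set m := N.+1%:R => uv m1.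
have {}uv : u <= v * (m / (m + b)).
  rewrite -ler_pdivrMr ?divr_gt0 //; last by lra.
  apply: le_trans uv; rewrite le_eqVlt; apply/orP; left; apply/eqP.
  by field; rewrite !gt_eqF //; lra.
rewrite [leLHS]addrC -lerBrDr -mulrBr.
apply: (@le_trans _ _ ((1 + b) / b * (v * (b / (m + b))))).
  rewrite [leRHS](_ : _ = v * ((1 + b) / (m + b))); last first.
    by field; rewrite !gt_eqF //; lra.
  rewrite ler_wpM2l // -[m^-1]mul1r ler_pdivrMr // mulrAC ler_pdivlMr; last lra.
  by rewrite mul1r; nra.
rewrite ler_wpM2l //; first by rewrite divr_ge0; lra.
rewrite lerBrDl -lerBrDr (le_trans uv) // -[X in _ <= X - _]mulr1 -mulrBr.
rewrite ler_wpM2l // le_eqVlt; apply/orP; left; apply/eqP; field.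
by rewrite !gt_eqF //; lra.
Qed.

Lemma sum_powR_tail_le (R : realType) (s : R) N M : 0 < s -> (0 < N <= M)%N ->
  \sum_(N <= n < M) n%:R `^ (- s - 1) <= (2 + s) / s * N%:R `^ (- s).
Proof.
move=> s0 /andP[N0 NM].
(* The term in M makes the bound telescope. The constant 2 + s comes from m + 1 + s <= m (2 + s) for
   m >= 1. *)
suff H : \sum_(N <= n < M) n%:R `^ (- s - 1) <=
    (2 + s) / s * (N%:R `^ (- s) - M%:R `^ (- s)).
  apply: le_trans H _; rewrite ler_wpM2l //; first by rewrite divr_ge0; lra.
  by rewrite gerBl powR_ge0.
rewrite -(subnKC NM); elim: (M - N)%N => [|k IH].
  by rewrite addn0 big_geq // subrr mulr0.
rewrite addnS big_nat_recr ?leq_addr //=.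
rewrite (le_trans (lerD IH (lexx _))) //.
move: (N + k)%N (leq_addr k N) => m Nm.
have m0 : 0 < m%:R :> R by rewrite ltr0n (leq_trans N0).
rewrite [leLHS]addrC -lerBrDr -mulrBr.
rewrite (_ : _ - _ - _ = m%:R `^ (- s) - m.+1%:R `^ (- s)); last by ring.
rewrite powRB ?(gt_eqF m0) ?implybT // (powRr1 (ltW m0)) !powRN.
have := powR_succ_ge m (ltW s0).
have m1 : 1 <= m%:R :> R by rewrite ler1n (leq_trans N0).
have : 0 < m%:R `^ s by rewrite powR_gt0.
have : 0 < m.+1%:R `^ s by rewrite powR_gt0.
set u := m%:R `^ s; set v := _ `^ s => v0 u0 uv.
have {}uv : v^-1 <= u^-1 * ((m.+1%:R) / (m.+1%:R + s)).
  rewrite [leRHS](_ : _ = (u * (1 + s / m.+1%:R))^-1); last first.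
    by field; rewrite !gt_eqF ?ltr0n //; lra.
  rewrite lef_pV2 // posrE // mulr_gt0 // addr_gt0 // divr_gt0 //.
apply: (@le_trans _ _ ((2 + s) / s * (u^-1 * (s / (m.+1%:R + s))))).
  rewrite [leRHS](_ : _ = u^-1 * ((2 + s) / (m.+1%:R + s))); last first.
    by field; rewrite !gt_eqF //; have := ltr0n R m.+1; lra.
  rewrite ler_wpM2l ?invr_ge0 ?(ltW u0) // -[_^-1]mul1r.
  rewrite ler_pdivrMr // mulrAC ler_pdivlMr; last by rewrite addr_gt0.
  by rewrite mul1r -natr1; nra.
rewrite ler_wpM2l //; first by rewrite divr_ge0; lra.
rewrite lerBrDl -lerBrDr (le_trans uv) // -[X in _ <= X - _]mulr1 -mulrBr.
rewrite ler_wpM2l ?invr_ge0 ?(ltW u0) // le_eqVlt; apply/orP; left; apply/eqP.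
by field; rewrite !gt_eqF // addr_gt0.
Qed.

Lemma harmonic_sum_le (R : realType) N : (0 < N)%N ->
  \sum_(1 <= n < N.+1) n%:R^-1 <= 1 + ln (N%:R : R).
Proof.
elim: N => // -[|N] IH _.
  by rewrite big_nat1 invr1 ln1 addr0.
rewrite big_nat_recr //= (le_trans (lerD (IH isT) (lexx _))) // -addrA lerD2l.
have N1 : 0 < N.+1%:R :> R by rewrite ltr0n.
have N2 : 0 < N.+2%:R :> R by rewrite ltr0n.
rewrite -[X in _ + X]expRK -lnM ?posrE ?expR_gt0 //.
by rewrite ler_ln ?posrE ?mulr_gt0 ?expR_gt0 // nat_mul_expR_le.
Qed.

(** * Complex series *)

Lemma normr_modulus (R : rcfType) (z : R[i]) : `|z| = (modulus z)%:C.
Proof. by []. Qed.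

Lemma modulus_real (R : rcfType) (r : R) : modulus r%:C = `|r|.
Proof. by rewrite /modulus /= expr0n /= addr0 sqrtr_sqr. Qed.

Lemma modulus_ge0 (R : rcfType) (z : R[i]) : 0 <= modulus z.
Proof. by case: z => a b; exact: sqrtr_ge0. Qed.

Lemma modulus_le_add (R : rcfType) (z : R[i]) :
  modulus z <= `|complex.Re z| + `|complex.Im z|.
Proof.
case: z => a b; rewrite /modulus /= -(ler_sqr (R := R)).
  2,3: by rewrite nnegrE ?sqrtr_ge0 ?addr_ge0.
rewrite sqr_sqrtr ?addr_ge0 ?sqr_ge0 // sqrrD !real_normK ?num_real //.
by rewrite lerD2r lerDl mulrn_wge0 // mulr_ge0.
Qed.

Lemma Re_le_modulus (R : rcfType) (z : R[i]) : `|complex.Re z| <= modulus z.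
Proof.
by case: z => a b; rewrite -sqrtr_sqr ler_wsqrtr // lerDl sqr_ge0.
Qed.

Lemma Im_le_modulus (R : rcfType) (z : R[i]) : `|complex.Im z| <= modulus z.
Proof.
by case: z => a b; rewrite -sqrtr_sqr ler_wsqrtr // lerDr sqr_ge0.
Qed.

Lemma modulus_sum (R : rcfType) (I : Type) (r : seq I) (P : pred I)
    (u : I -> R[i]) :
  modulus (\sum_(i <- r | P i) u i) <= \sum_(i <- r | P i) modulus (u i).
Proof.
elim/big_ind2: _ => // [|x a y b xa yb]; first by rewrite /modulus Normc.normc0.
by rewrite (le_trans (le_normcD _ _)) // lerD.
Qed.

Lemma real_cvg_tail (R : realType) (v T : nat -> R) :
  (forall N M, (0 < N <= M)%N -> `|v M - v N| <= T N) ->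
  (forall e, 0 < e -> exists N0, forall N, (N0 <= N)%N -> T N <= e) ->
  exists l : R, (v @ \oo --> l)%classic.
Proof.
move=> vT T0; apply/cvg_ex/cauchy_cvgP/cauchy_exP => e e0.
have [N0 HN0] := T0 (e / 2) (divr_gt0 e0 (ltr0Sn R 1)).
exists (v N0.+1); exists N0.+1 => //= M NM.
rewrite /= -ball_normE /= distrC (le_lt_trans (vT N0.+1 M _)) ?NM //.
by rewrite (le_lt_trans (HN0 _ _)) //; lra.
Qed.

(** Real and imaginary parts of the partial sums are Cauchy, hence converge; the tail bound, uniform
    in M, passes to the limit. *)
Lemma complex_series_tail (R : realType) (u : nat -> R[i]) (T : nat -> R) :
  (forall N M, (0 < N <= M)%N -> \sum_(N <= n < M) modulus (u n) <= T N) ->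
  (forall e, 0 < e -> exists N0, forall N, (N0 <= N)%N -> T N <= e) ->
  exists2 S, series_sum u S &
    forall N, (0 < N)%N -> modulus (\sum_(1 <= n < N) u n - S) <= T N.
Proof.
move=> uT T0; pose U N := \sum_(1 <= n < N) u n.
have UT N M : (0 < N <= M)%N -> modulus (U M - U N) <= T N.
  move=> NM; apply: le_trans (uT N M NM); apply: le_trans (modulus_sum _ _ _).
  case/andP: NM => N0 NM; rewrite /U (big_cat_nat (n := N)) //=.
  by rewrite addrAC subrr add0r.
have [a Ha] : exists a, ((fun N => complex.Re (U N)) @ \oo --> (a : R))%classic.
  apply: real_cvg_tail T0 => N M NM.
  by rewrite -raddfB (le_trans (Re_le_modulus _)) // UT.
have [b Hb] : exists b, ((fun N => complex.Im (U N)) @ \oo --> (b : R))%classic.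
  apply: real_cvg_tail T0 => N M NM.
  by rewrite -raddfB (le_trans (Im_le_modulus _)) // UT.
pose S : R[i] := a +i* b.
have US e : 0 < e -> (\forall M \near \oo, modulus (U M - S) <= e)%classic.
  move=> e0; have e2 : 0 < e / 2 by lra.
  move/cvgrPdist_le: Ha => /(_ _ e2) Ha; move/cvgrPdist_le: Hb => /(_ _ e2) Hb.
  near=> M; apply: le_trans (modulus_le_add _) _.
  rewrite !raddfB /= [leRHS]splitr distrC [X in _ + X]distrC.
  by apply: lerD; near: M.
exists S.
  (* Norms on [R[i]] take values in [R[i]]; a positive e there has zero imaginary part, so its real
     part serves as radius. *)
  apply/cvgrPdist_le => e; rewrite ltcE /= => /andP[/eqP e0 ep].
  apply: filterS (US _ ep) => M HM.
  rewrite distrC normr_modulus lecE /= e0 eqxx /=; exact: HM.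
move=> N N0; apply/ler_addgt0Pr => e e0.
have [M0 _ HM0] := US e e0.
have NM : (0 < N <= maxn N M0)%N by rewrite N0 leq_maxl.
have {}HM0 := HM0 (maxn N M0) (leq_maxr _ _).
rewrite -[X in modulus X](subrKA (U (maxn N M0))) /modulus.
apply: le_trans (le_normcD _ _) _; apply: lerD => //.
by rewrite -normcN opprB; exact: UT.
Unshelve. all: by end_near.
Qed.

Lemma powRN_cvg0 (R : realType) (C s e : R) : 0 <= C -> 0 < s -> 0 < e ->
  exists N0, forall N, (N0 <= N)%N -> C * N%:R `^ (- s) <= e.
Proof.
(* Adding 1 keeps t positive when C = 0; N^s >= t then suffices. *)
move=> C0 s0 e0; pose t := (C + 1) / e.
have t0 : 0 < t by rewrite divr_gt0 //; lra.
exists (Num.truncn (t `^ s^-1)).+1 => N tN.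
have H : t `^ s^-1 <= N%:R.
  by rewrite (le_trans (ltW (truncnS_gt _))) // ler_nat.
have : t <= N%:R `^ s.
  rewrite -[leLHS](powRr1 (ltW t0)) -[X in t `^ X](mulVf (lt0r_neq0 s0)) powRrM.
  by apply: ge0_ler_powR; rewrite ?nnegrE ?powR_ge0 ?ler0n ?(ltW s0).
rewrite powRN; set v := _ `^ s => tv; have v0 : 0 < v by exact: lt_le_trans tv.
rewrite ler_pdivrMr //; move: tv; rewrite /t ler_pdivrMr // [v * e]mulrC.
by move=> ?; lra.
Qed.

(** * The remainder *)

(** Since f(a, b)^2 <= a + b <= 2M < (L + 1)^2, every value of f is at most L, and Moebius inversion
    applies with the common bound L. *)
Lemma sum_gcd_ratio (A : pzRingType) (h : nat -> A) M L :
  (2 * M < L.+1 ^ 2)%N ->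
  \sum_(1 <= a < M.+1) \sum_(1 <= b < M.+1) h (gcd_ratio a b) =
  \sum_(1 <= n < L.+1) moebius_conv h n *
    (paircount (fun a b => n %| gcd_ratio a b)%N M)%:R.
Proof.
move=> ML.
transitivity (\sum_(1 <= a < M.+1) \sum_(1 <= b < M.+1) \sum_(1 <= n < L.+1)
    moebius_conv h n * (n %| gcd_ratio a b)%N%:R).
  apply: eq_big_nat => a /andP[a0 aM]; apply: eq_big_nat => b /andP[b0 bM].
  rewrite (@moebius_inversion _ h _ L).
    rewrite big_mkcond; apply: eq_bigr => n _.
    by case: (n %| _)%N; rewrite ?mulr1 ?mulr0.
  rewrite gcd_ratio_gt0 // -ltnS -ltn_sqr.
  by have := gcd_ratio_sqr_le a0 b0; lia.
under eq_bigr do rewrite exchange_big_nat.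
rewrite exchange_big_nat /=; apply: eq_bigr => n _.
rewrite /paircount natr_sum mulr_sumr; apply: eq_bigr => a _.
by rewrite natr_sum mulr_sumr.
Qed.

Lemma dedekind_psi_complex (R : rcfType) n :
  dedekind_psi R[i] n = (dedekind_psi R n)%:C.
Proof.
rewrite /dedekind_psi rmorphM rmorph_nat rmorph_prod; congr (_ * _).
by apply: eq_bigr => p _; rewrite rmorphD rmorph1 fmorphV rmorph_nat.
Qed.

Lemma dedekind_psi_ge (R : realFieldType) n : n%:R <= dedekind_psi R n.
Proof.
rewrite /dedekind_psi ler_peMr ?ler0n //.
elim/big_rec: _ => // p x _ x1.
have p0 : 0 <= p%:R^-1 :> R by rewrite invr_ge0 ler0n.
by nra.
Qed.

(** From psi(n) >= n. The exponent beta - 3 is written in the shape that [sum_powR_tail_le] expects,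
    with s = 2 - beta. *)
Lemma moebius_term_le (R : realType) (h : nat -> R[i]) (beta K : R) n :
  (0 < n)%N -> modulus (moebius_conv h n) <= K * n%:R `^ beta ->
  modulus (moebius_conv h n / (n%:R ^+ 2 * dedekind_psi _ n)) <=
    K * n%:R `^ (- (2 - beta) - 1).
Proof.
move=> n0 hK; have n0R : 0 < n%:R :> R by rewrite ltr0n.
have psi_ge := dedekind_psi_ge R n.
have psi0 : 0 < dedekind_psi R n by exact: lt_le_trans psi_ge.
have d0 : 0 < n%:R ^+ 2 * dedekind_psi R n by rewrite mulr_gt0 // exprn_gt0.
rewrite dedekind_psi_complex -(rmorph_nat (real_complex R)) -rmorphXn -rmorphM.
rewrite -fmorphV /modulus Normc.normcM -!/(modulus _) modulus_real.
rewrite ger0_norm ?invr_ge0 ?(ltW d0) //.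
rewrite (_ : - (2 - beta) - 1 = beta - 3%:R); last by ring.
rewrite powRB ?(gt_eqF n0R) ?implybT // powR_mulrn ?ler0n // mulrA.
apply: ler_pM => //; first exact: modulus_ge0.
  by rewrite invr_ge0 ltW.
rewrite lef_pV2 ?posrE ?exprn_gt0 //.
by rewrite exprSr ler_wpM2l // exprn_ge0.
Qed.

Lemma ln_primes_le (R : realType) n : (0 < n)%N ->
  (size (primes n))%:R * ln 2 <= ln (n%:R : R).
Proof.
move=> n0; rewrite mulr_natl -lnXn // ler_ln ?posrE ?exprn_gt0 ?ltr0n //.
by rewrite -natrX ler_nat exp2_primes.
Qed.

(** The upper bound on L controls ln L and L^beta; the lower bounds on L + 1 serve the tail of the
    series and the cutoff in [sum_gcd_ratio]. *)
Lemma truncn_sqrt2 (R : realType) (x : R) : 1 <= x ->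
  let L := Num.truncn (Num.sqrt (2 * x)) in
  [/\ (0 < L)%N, (L%:R ^+ 2 <= 2 * x), x <= L.+1%:R ^+ 2 &
    (2 * Num.truncn x < L.+1 ^ 2)%N].
Proof.
move=> x1 L; have x2 : 0 <= 2 * x by lra.
have /andP[Ls sL] := truncn_itv (sqrtr_ge0 (2 * x)); rewrite -/L in Ls sL.
have s2 : Num.sqrt (2 * x) ^+ 2 = 2 * x by rewrite sqr_sqrtr.
have LL : L%:R ^+ 2 <= 2 * x by rewrite -s2 ler_sqr ?nnegrE ?sqrtr_ge0.
have LU : 2 * x < L.+1%:R ^+ 2 by rewrite -s2 ltr_sqr ?nnegrE ?sqrtr_ge0.
split=> //.
- by rewrite truncn_gt0 -[leLHS](sqrtr1 R) ler_sqrt //; lra.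
- lra.
have tx : (Num.truncn x)%:R <= x by rewrite truncn_le; lra.
rewrite -(ltr_nat R) natrM natrX; lra.
Qed.

(** One bound for all ranges of beta: the first summand collects the counting errors for n <= L, the
    second is x^2 times the tail of the series. *)
Lemma gcd_ratio_rem_le (R : realType) (h : nat -> R[i]) (beta K : R) :
  beta < 2 -> 0 <= K ->
  (forall n : nat, (0 < n)%N ->
    modulus (moebius_conv h n) <= K * n%:R `^ beta) ->
  exists2 S : R[i],
    series_sum (fun n => moebius_conv h n / (n%:R ^+ 2 * dedekind_psi _ n)) S &
    forall x0, 1 < x0 -> exists2 D, 0 <= D & forall x, x0 <= x ->
      exists L, [/\ (0 < L)%N, L%:R ^+ 2 <= 2 * x &
        modulus (gcd_ratio_sum h x - (x ^+ 2)%:C * S) <=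
          D * (x * ln x *
                 (\sum_(1 <= n < L.+1) modulus (moebius_conv h n) / n%:R) +
               x `^ (1 + beta / 2))].
Proof.
move=> b2 K0 hK; have s0 : 0 < 2 - beta by lra.
pose s := 2 - beta; pose C := K * ((2 + s) / s).
have C0 : 0 <= C by rewrite mulr_ge0 // divr_ge0 /s; lra.
pose t n := moebius_conv h n / (n%:R ^+ 2 * dedekind_psi R[i] n).
have [|e e0|S HS HT] := @complex_series_tail R t (fun N => C * N%:R `^ (- s)).
- move=> N M NM; have /andP[N0 _] := NM.
  apply: (@le_trans _ _ (\sum_(N <= n < M) K * n%:R `^ (- s - 1))).
    apply: ler_sum_nat => n /andP[Nn _].
    have n0 : (0 < n)%N by exact: leq_trans N0 Nn.
    by apply: moebius_term_le => //; exact: hK.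
  by rewrite -mulr_sumr /C -mulrA ler_wpM2l // sum_powR_tail_le.
- exact: powRN_cvg0.
exists S => // x0 x01; have lx0 : 0 < ln x0 by rewrite ln_gt0.
have l2 : 0 < ln 2 :> R by rewrite ln_gt0 // ltr1n.
(* Chosen so that 1 + omega(n) <= 1 + ln(2x)/ln 2 = 2 + ln x/ln 2 <= D0 ln x, using 1 <= ln x/ln
   x0. *)
pose D0 := 2 / ln x0 + (ln 2)^-1.
have D00 : 0 <= D0 by rewrite addr_ge0 ?invr_ge0 ?divr_ge0 // ltW.
exists (2 * D0 + C); first by rewrite addr_ge0 // mulr_ge0.
move=> x x0x; have x1 : 1 <= x by lra.
have [L0 L2 xL ML] := truncn_sqrt2 x1.
set L := Num.truncn _ in L0 L2 xL ML; exists L; split=> //.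
have lnx : ln x0 <= ln x by rewrite ler_ln ?posrE //; lra.
have lnL : ln (L%:R : R) <= ln 2 + ln x.
  rewrite -lnM ?posrE //; last lra.
  rewrite ler_ln ?posrE ?ltr0n //; last by lra.
  apply: le_trans L2; rewrite expr2 ler_peMr ?ler0n // ler1n //.
have omega n : (0 < n <= L)%N -> 1 + (size (primes n))%:R <= D0 * ln x.
  move=> /andP[n0 nL].
  have H1 : (size (primes n))%:R <= (ln 2 + ln x) / ln 2.
    rewrite ler_pdivlMr // (le_trans (ln_primes_le R n0)) //.
    rewrite (le_trans _ lnL) //.
    by rewrite ler_ln ?posrE ?ltr0n // ler_nat.
  have H2 : 1 <= ln x / ln x0 by rewrite ler_pdivlMr // mul1r.
  have -> : D0 * ln x = 2 * (ln x / ln x0) + ln x / ln 2.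
    by rewrite /D0 mulrDl mulrAC -mulrA [_^-1 * _]mulrC.
  move: H1; rewrite mulrDl divff ?gt_eqF //; lra.
pose P n := paircount (fun a b => n %| gcd_ratio a b)%N (Num.truncn x).
rewrite /gcd_ratio_sum (sum_gcd_ratio h ML).
have -> : \sum_(1 <= n < L.+1) moebius_conv h n * (P n)%:R - (x ^+ 2)%:C * S =
    \sum_(1 <= n < L.+1) moebius_conv h n *
      ((P n)%:R - x ^+ 2 / (n%:R ^+ 2 * dedekind_psi R n))%:C +
    (x ^+ 2)%:C * (\sum_(1 <= n < L.+1) t n - S).
  rewrite mulrBr addrA; congr (_ - _).
  rewrite mulr_sumr -big_split; apply: eq_bigr => n _ /=.
  rewrite /t dedekind_psi_complex rmorphB fmorph_div rmorphXn rmorphM rmorphXn.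
  rewrite !rmorph_nat mulrBr [X in _ = _ + X]mulrCA.
  by rewrite (rmorphXn (real_complex R)) /= subrK.
rewrite [leRHS]mulrDr; apply: le_trans (le_normcD _ _) _.
rewrite -!/(modulus _). apply: lerD.
  apply: le_trans (modulus_sum _ _ _) _; rewrite mulr_sumr mulr_sumr.
  apply: ler_sum_nat => n /andP[n0 nL].
  rewrite /modulus Normc.normcM -!/(modulus _) modulus_real.
  have x00 : 0 <= x by lra.
  have := gcd_ratio_count_approx n0 x00; rewrite -/(P n) => HP.
  have HG := modulus_ge0 (moebius_conv h n).
  apply: (@le_trans _ _ (modulus (moebius_conv h n) *
      (2 * (D0 * ln x) * (x / n%:R)))).
    rewrite ler_wpM2l // (le_trans HP) // ler_wpM2r ?divr_ge0 //.
    by rewrite ler_wpM2l // omega // n0.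
  rewrite (_ : _ * (2 * _ * _) =
    2 * D0 * (x * ln x * (modulus (moebius_conv h n) / n%:R))); last by ring.
  rewrite ler_wpM2r ?lerDl //.
  by rewrite !mulr_ge0 ?invr_ge0 ?ln_ge0.
rewrite /modulus Normc.normcM -!/(modulus _) modulus_real ger0_norm ?sqr_ge0 //.
have x0' : 0 < x by lra.
(* The tail is at most C (L + 1)^(-s), and (L + 1)^2 >= x turns this into C x^(-s/2). *)
have E : x `^ (1 + beta / 2) = x ^+ 2 * x `^ (- (s / 2)).
  rewrite -powR_mulrn ?(ltW x0') // -powRD ?(gt_eqF x0') ?implybT //.
  by congr (_ `^ _); rewrite /s; field.
apply: (@le_trans _ _ (x ^+ 2 * (C * x `^ (- (s / 2))))).
  rewrite ler_wpM2l ?sqr_ge0 // (le_trans (HT L.+1 _)) // ler_wpM2l //.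
  have xs : 0 < x `^ (s / 2) by rewrite powR_gt0.
  have Ls : 0 < L.+1%:R `^ s by rewrite powR_gt0.
  rewrite !powRN lef_pV2 ?posrE //.
  have -> : L.+1%:R `^ s = (L.+1%:R ^+ 2) `^ (s / 2).
    rewrite -powR_mulrn ?ler0n // -powRrM; congr (_ `^ _); by field.
  apply: ge0_ler_powR; rewrite ?nnegrE ?sqr_ge0 ?(ltW x0') //.
  by rewrite divr_ge0 // ltW.
rewrite E mulrCA; apply: ler_wpM2r.
  by rewrite mulr_ge0 ?sqr_ge0 ?powR_ge0.
by rewrite lerDr mulr_ge0.
Qed.

(** * The three ranges of beta *)

Lemma sum_div_powR_le (R : realType) (G : nat -> R) (beta K : R) L :
  (forall n, (0 < n)%N -> G n <= K * n%:R `^ beta) ->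
  \sum_(1 <= n < L.+1) G n / n%:R <=
    K * \sum_(1 <= n < L.+1) n%:R `^ (beta - 1).
Proof.
move=> GK; rewrite mulr_sumr; apply: ler_sum_nat => n /andP[n0 _].
have n0R : 0 < n%:R :> R by rewrite ltr0n.
rewrite powRB ?(gt_eqF n0R) ?implybT // powRr1 ?ler0n // mulrA.
by rewrite ler_wpM2r ?GK // invr_ge0 ler0n.
Qed.

Theorem theorem1 (R : realType) (h : nat -> R[i]) (beta : R)
    (hbeta : beta < 2)
    (hh : exists K : R, forall n : nat, (0 < n)%N ->
      modulus (moebius_conv h n) <= K * n%:R `^ beta) :
  exists2 S : R[i],
    series_sum (fun n => moebius_conv h n / (n%:R ^+ 2 * dedekind_psi _ n)) S &
    let rem (x : R) : R[i] := gcd_ratio_sum h x - (x ^+ 2)%:C * S in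
    let abs_sum : \bar R :=
      (\sum_(1 <= n <oo) (modulus (moebius_conv h n) / n%:R)%:E)%E in
    [/\ 0 < beta ->
          vinogradov rem (fun x => x `^ (1 + beta / 2) * ln x),
        beta = 0 /\ abs_sum = +oo%E ->
          vinogradov rem (fun x => x * ln x ^+ 3) &
        (beta = 0 /\ (abs_sum < +oo)%E) \/ beta < 0 ->
          vinogradov rem (fun x => x * ln x ^+ 2)].
Proof.
have [K hK] := hh.
have K0 : 0 <= K.
  have := hK 1%N isT; rewrite powR1 mulr1; exact: le_trans (modulus_ge0 _).
have [S HS Hrem] := gcd_ratio_rem_le hbeta K0 hK.
exists S => // rem abs_sum.
pose A L := \sum_(1 <= n < L.+1) modulus (moebius_conv h n) / n%:R.
have HA L := sum_div_powR_le L hK; rewrite -/(A _) in HA.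
split.
- move=> b0 x0 x01; have lx0 : 0 < ln x0 by rewrite ln_gt0.
  have [D D0 HD] := Hrem x0 x01.
  (* B comes from [sum_powR_le] and L^beta <= (2x)^(beta/2); the summand 1/ln x0 below supplies the
     logarithm missing from the tail term. *)
  pose B := K * ((1 + beta) / beta) * 2 `^ (beta / 2).
  exists (D * (B + (ln x0)^-1)) => x x0x.
  have [L [L0 L2 /le_trans]] := HD x x0x; apply.
  rewrite -/(A L) -[leRHS]mulrA ler_wpM2l //.
  have xp : 0 < x by lra.
  have lnx : ln x0 <= ln x by rewrite ler_ln ?posrE //; lra.
  have xD : x `^ (1 + beta / 2) = x * x `^ (beta / 2).
    by rewrite powRD ?(gt_eqF xp) ?implybT // powRr1 // ltW.
  have AL : A L <= B * x `^ (beta / 2).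
    rewrite (le_trans (HA L)) // /B -!mulrA ler_wpM2l //.
    rewrite (le_trans (sum_powR_le L b0)) // -mulrA.
    have -> : 2 `^ (beta / 2) * x `^ (beta / 2) = (2 * x) `^ (beta / 2).
      by rewrite powRM // ltW.
    rewrite ler_wpM2l //; first lra.
    rewrite ler_wpM2l ?invr_ge0 ?(ltW b0) //.
    have -> : L%:R `^ beta = (L%:R ^+ 2) `^ (beta / 2).
      by rewrite -powR_mulrn ?ler0n // -powRrM; congr (_ `^ _); field.
    by apply: ge0_ler_powR; rewrite ?nnegrE //; lra.
  rewrite mulrDl; apply: lerD.
    rewrite xD (_ : B * _ = x * ln x * (B * x `^ (beta / 2))); last by ring.
    by rewrite ler_wpM2l // mulr_ge0 //; lra.
  rewrite mulrCA ler_peMr ?powR_ge0 // mulrC ler_pdivlMr // mul1r //.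
- move=> [b0 _] x0 x01; have lx0 : 0 < ln x0 by rewrite ln_gt0.
  have [D D0 HD] := Hrem x0 x01.
  have l2 : 0 < ln 2 :> R by rewrite ln_gt0 // ltr1n.
  (* From 1 + ln L <= 1 + ln 2 + ln x, where the constant 1 + ln 2 is absorbed through 1 <= ln x/ln
     x0. *)
  pose B := K * ((1 + ln 2) / ln x0 + 1).
  exists (D * (B / ln x0 + (ln x0)^-1 ^+ 3)) => x x0x.
  have [L [L0 L2 /le_trans]] := HD x x0x; apply.
  rewrite -/(A L) -[leRHS]mulrA ler_wpM2l //.
  have xp : 0 < x by lra.
  have lnx : ln x0 <= ln x by rewrite ler_ln ?posrE //; lra.
  have l1 : 1 <= (ln x0)^-1 * ln x by rewrite mulrC ler_pdivlMr // mul1r.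
  have AL : A L <= B * ln x.
    rewrite (le_trans (HA L)) // -mulrA ler_wpM2l // b0 sub0r.
    under eq_bigr do rewrite powR_inv1 ?ler0n //.
    rewrite (le_trans (harmonic_sum_le R L0)) //.
    have lnL : ln (L%:R : R) <= ln 2 + ln x.
      rewrite -lnM ?posrE // ler_ln ?posrE ?ltr0n ?mulr_gt0 //.
      by apply: le_trans L2; rewrite expr2 ler_peMr ?ler0n // ler1n.
    have H : 1 + ln 2 <= (1 + ln 2) * ((ln x0)^-1 * ln x).
      by rewrite ler_peMr // addr_ge0 // ltW.
    by rewrite [leRHS]mulrDl mul1r -[X in _ <= X + _]mulrA; lra.
  rewrite b0 mul0r addr0 powRr1 ?(ltW xp) // mulrDl; apply: lerD.
    (* The harmonic sum yields x (ln x)^2; the third logarithm is the factor ln x/ln x0 >= 1. *)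
    rewrite (_ : B / _ * _ = x * ln x * (B * ln x * ((ln x0)^-1 * ln x)));
      last first.
      by ring.
    rewrite ler_wpM2l ?mulr_ge0 //; [lra|lra|].
    rewrite (le_trans AL) // ler_peMr //.
    by apply: le_trans AL; apply: sumr_ge0 => n _;
      rewrite divr_ge0 ?modulus_ge0.
  rewrite (mulrCA _ x) -exprMn ler_peMr ?(ltW xp) //.
  exact: exprn_ege1.
move=> Hb x0 x01; have lx0 : 0 < ln x0 by rewrite ln_gt0.
have [D D0 HD] := Hrem x0 x01.
have b0 : beta <= 0 by case: Hb => [[-> _] //|/ltW].
(* The partial sums are bounded uniformly in L: by the finite sum of the series if beta = 0, by the
   tail estimate from N = 1 with s = -beta if beta < 0. *)
have [B B0 HB] : exists2 B, 0 <= B & forall L, (0 < L)%N -> A L <= B.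
  case: Hb => [[_ fin]|bn].
    have nn n : (0 <= (modulus (moebius_conv h n) / n%:R)%:E)%E.
      by rewrite lee_fin divr_ge0 ?modulus_ge0.
    have as0 : (0 <= abs_sum)%E by exact: nneseries_ge0.
    exists (fine abs_sum); first exact: fine_ge0.
    move=> L _; rewrite -lee_fin fineK ?ge0_fin_numE // -sumEFin.
    exact: nneseries_lim_ge.
  exists (K * ((2 - beta) / - beta)).
    by rewrite mulr_ge0 // divr_ge0; lra.
  move=> L L0; rewrite (le_trans (HA L)) // ler_wpM2l //.
  have nb0 : 0 < - beta by lra.
  have := sum_powR_tail_le (N := 1) (M := L.+1) nb0 isT.
  by rewrite opprK powR1 mulr1.
exists (D * (B / ln x0 + (ln x0)^-1 ^+ 2)) => x x0x.
have [L [L0 L2 /le_trans]] := HD x x0x; apply.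
rewrite -/(A L) -[leRHS]mulrA ler_wpM2l //.
have xp : 0 < x by lra.
have lnx : ln x0 <= ln x by rewrite ler_ln ?posrE //; lra.
have l1 : 1 <= (ln x0)^-1 * ln x by rewrite mulrC ler_pdivlMr // mul1r.
rewrite mulrDl; apply: lerD.
  rewrite (_ : B / _ * _ = x * ln x * (B * ((ln x0)^-1 * ln x))); last by ring.
  rewrite ler_wpM2l ?mulr_ge0 //; [lra|lra|].
  by rewrite (le_trans (HB L L0)) // ler_peMr.
(* As beta <= 0 and x > 1, x^(1 + beta/2) <= x. *)
rewrite (mulrCA _ x) -exprMn; apply: (@le_trans _ _ x).
  rewrite -[leRHS](powRr1 (ltW xp)) ler_powR //; lra.
by rewrite ler_peMr ?(ltW xp) // exprn_ege1.
Qed.
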